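(* Let $\mathfrak M=\langle S,\mathcal L\rangle$ be a partial Steiner triple system, let $m\ge 3$ be an integer, and let $\Delta$ be a triangle in $\mathfrak B=\circledast^{m}\mathfrak M$. Then one of the following holds (for some $i\in C_m$). (i) $\Delta=\{(a,i),(b,i),(c,i)\}$, where $\Delta_0:=\{a,b,c\}$ is a triangle of $\mathfrak M$. In this case $\Delta'$ is a triangle in $\mathfrak B$ if $\Delta_0'$ is either a triangle or a line of $\mathfrak M$. If $\Delta_0'$ is a line, then the (periodic) series $\Delta',\Delta'',\ldots,\Delta^{(m)},\Delta^{(m+1)}=\Delta'$ consists of triangles distinct from $\Delta$. In any case $\Delta'$ is not a line of $\mathfrak B$. Moreover, $\Delta,\Delta',\ldots,\Delta^{(m-1)},\Delta^{(m)}=\Delta$ is a periodic series of triangles iff there is a positive integer $m_0$ such that $\Delta_0,\Delta_0',\ldots,\Delta_0^{(m_0-1)},\Delta_0^{(m_0)}=\Delta_0$ is a periodic series of triangles in $\mathfrak M$ and $m_0$ divides $m$. (ii) $\Delta=\{(a,i),(b,i),(c,i)\}$, where $\{a,b,c\}$ is a line of $\mathfrak M$. Then the (periodic) series $\Delta,\Delta',\ldots,\Delta^{(m-1)},\Delta^{(m)}=\Delta$ consists of triangles. (iii) $\Delta=\{(a,i),(b,i),(c,i-1)\}$, where $\{a,b,c\}$ is a line of $\mathfrak M$. Then $\Delta'$ is not a line. If $m\neq 3$ then $\Delta'$ is not a triangle: it consists of a pair of collinear points $p,q$ and a point $r$ not collinear with any of $p,q$. If $m=3$ then $\Delta'$ is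 a triangle. (iv) $\Delta=\{(a,i),(b,i),(c,i-1)\}$, where $\Delta_0=\{a,b,c\}$ is a triangle of $\mathfrak M$. Then $\Delta'$ is not a line. If $m\ne 3$ then $\Delta'$ is not a triangle: it either consists of a pair of collinear points $p,q$ and a point $r$ not collinear with any of $p,q$, or consists of three pairwise noncollinear points. If $m=3$ then $\Delta'$ is a triangle iff the points in $\Delta_0'$ are pairwise collinear. (v) $\Delta=\{(a,i),(b,i),(c,i+1)\}$, where $\Delta_0:=\{a,b,c\}$ is a triangle of $\mathfrak M$. Then $\Delta'$ is a line of $\mathfrak B$ iff $\Delta_0'$ is a line of $\mathfrak M$. If $\Delta_0'$ is a triangle then $\Delta'$ is a triangle as well. (vi) $\Delta=\{(a,i),(b,i+1),(c,i+2)\}$, where $\Delta_0:=\{a,b,c\}$ is a triangle of $\mathfrak M$. The sequence $\Delta^{(j)}$ behaves as described in (i), i.e. all the assertions made in (i) about $\Delta',\Delta'',\ldots$ hold. (vii) $\Delta=\{(a,i),(b,i+1),(c,i+2)\}$, where $\{a,b,c\}$ is a line of $\mathfrak M$. The sequence $\Delta^{(j)}$ behaves as described in (ii), i.e. $\Delta,\Delta',\ldots,\Delta^{(m-1)},\Delta^{(m)}=\Delta$ consists of triangles. If $m\neq 3$ then $\mathfrak B$ contains no triangles of types (vi) and (vii) (for $m=3$ such triangles are not excluded). If $\Delta$ has type (vii), then there is in $\mathfrak B$ a triangle $\Delta_1$ of type (ii) such that $\Delta\cup\Delta'\cup\Delta''=\Delta_1\cup\Delta_1'\cup\Delta_1'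'$.
   Context: A partial Steiner triple system (PSTS) is a structure $\mathfrak M=\langle S,\mathcal L\rangle$ with point set $S$ and a family $\mathcal L$ of 3-element subsets of $S$ (lines) such that any two distinct points lie on at most one line. Points are collinear if they lie on a common line. $C_m$ is the cyclic group of integers modulo $m$. For an integer $m\ge 3$, the $m$-weaved configuration $\circledast^{m}\mathfrak M$ has point set $S\times C_m$ and its lines are all the sets $\{(a,i),(b,i),(c,i+1)\}$ with $\{a,b,c\}\in\mathcal L$ (in any ordering of $a,b,c$) and $i\in C_m$; it is again a PSTS. In a PSTS, $p\circledcirc q$ is the partial operation: $p\circledcirc p=p$, and $p\circledcirc q=r$ when $\{p,q,r\}$ is a line. A triangle is a set of three pairwise collinear points that do not lie on one line. For a 3-element set $\Delta=\{p,q,r\}$ of pairwise collinear points put $\Delta'=\{p\circledcirc q,\,q\circledcirc r,\,r\circledcirc p\}$; inductively $\Delta^{(0)}=\Delta$, $\Delta^{(n+1)}=(\Delta^{(n)})'$ whenever the points of $\Delta^{(n)}$ are pairwise collinear.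
   Formalization: In (vi), the ''iff'' also requires that Δ₀^(m₀)=Δ₀ hold vertex by vertex (not only as a set), since the literal claim fails when the vertices return permuted; with set equality only, Δ,…,Δ^(m-1) are still shown to be triangles. *)

(* Defs.v *)
From mathcomp Require Import all_boot all_algebra.
From mathcomp Require Import boolp classical_sets.

Set Implicit Arguments.
Unset Strict Implicit.
Unset Printing Implicit Defensive.

Local Open Scope classical_set_scope.

(* A partial Steiner triple system is represented by its family of lines
   L : set (set S); the points are all the inhabitants of S, and S may be
   infinite. *)

Definition distinct3 (T : Type) (p q r : T) : Prop :=
  [/\ p <> q, q <> r & r <> p].

Definition three_set (T : Type) (A : set T) : Prop :=
  exists p q r, distinct3 p q r /\ A = [set p; q; r].

Definition psts (S : Type) (L : set (set S)) : Prop :=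
  (forall l, L l -> three_set l) /\
  (forall p q l1 l2, p <> q -> L l1 -> L l2 ->
     l1 p -> l1 q -> l2 p -> l2 q -> l1 = l2).

Definition collinear (S : Type) (L : set (set S)) (p q : S) : Prop :=
  exists l, [/\ L l, l p & l q].

Definition pairwise_collinear (S : Type) (L : set (set S)) (A : set S) : Prop :=
  forall p q, A p -> A q -> p <> q -> collinear L p q.

Definition pairwise_noncollinear (S : Type) (L : set (set S)) (A : set S) :
    Prop :=
  forall p q, A p -> A q -> p <> q -> ~ collinear L p q.

Definition triangle (S : Type) (L : set (set S)) (A : set S) : Prop :=
  [/\ three_set A, pairwise_collinear L A
    & ~ exists l, L l /\ A `<=` l].

Definition pair_and_point (S : Type) (L : set (set S)) (A : set S) : Prop :=
  exists p q r, [/\ distinct3 p q r, A = [set p; q; r], collinear L p q,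
    ~ collinear L r p & ~ collinear L r q].

(* The graph of the partial operation: circ L p q r says that the product of
   p and q is defined and equal to r. *)
Definition circ (S : Type) (L : set (set S)) (p q r : S) : Prop :=
  (p = q /\ r = p) \/ (p <> q /\ L [set p; q; r]).

(* For a set {p, q, r} of three pairwise collinear points this is the set of
   the three products of p and q, of q and r, and of r and p.  On other sets
   the value is irrelevant: below, [deriveds L n A] is only considered when
   all the preceding terms consist of three pairwise collinear points. *)
Definition derived (S : Type) (L : set (set S)) (A : set S) : set S :=
  [set x | exists p q, [/\ A p, A q, p <> q & circ L p q x]].

Definition deriveds (S : Type) (L : set (set S)) (n : nat) (A : set S) : set S :=
  iter n (derived L) A.

(* A, A', ..., A^(k) = A is a periodic series of triangles; k need not be the
   least period. *)
Definition periodic_triangles (S : Type) (L : set (set S)) (k : nat)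
    (A : set S) : Prop :=
  (forall j, (j < k)%N -> triangle L (deriveds L j A)) /\ deriveds L k A = A.

(* 'Z_m is the cyclic group of integers modulo m as soon as 1 < m.  The
   quantification over a, b, c covers all the orderings of a line. *)
Definition weave (m : nat) (S : Type) (L : set (set S)) :
    set (set (S * 'Z_m)) :=
  [set l | exists a b c (i : 'Z_m), L [set a; b; c] /\
     l = [set (a, i); (b, i); (c, (i + 1)%R)]].

Arguments weave m {S} L.

Section Types.
Variables (S : Type) (L : set (set S)) (m : nat).
Implicit Types (a b c : S) (D : set (S * 'Z_m)).

Definition type_i D a b c : Prop := triangle L [set a; b; c] /\
  exists i : 'Z_m, D = [set (a, i); (b, i); (c, i)].

Definition type_ii D a b c : Prop := L [set a; b; c] /\
  exists i : 'Z_m, D = [set (a, i); (b, i); (c, i)].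

Definition type_iii D a b c : Prop := L [set a; b; c] /\
  exists i : 'Z_m, D = [set (a, i); (b, i); (c, (i - 1)%R)].

Definition type_iv D a b c : Prop := triangle L [set a; b; c] /\
  exists i : 'Z_m, D = [set (a, i); (b, i); (c, (i - 1)%R)].

Definition type_v D a b c : Prop := triangle L [set a; b; c] /\
  exists i : 'Z_m, D = [set (a, i); (b, i); (c, (i + 1)%R)].

Definition type_vi D a b c : Prop := triangle L [set a; b; c] /\
  exists i : 'Z_m, D = [set (a, i); (b, (i + 1)%R); (c, (i + 2%:R)%R)].

Definition type_vii D a b c : Prop := L [set a; b; c] /\
  exists i : 'Z_m, D = [set (a, i); (b, (i + 1)%R); (c, (i + 2%:R)%R)].

(* Stated for a D of type_i or type_vi,
   D0 being the projection of D on S. *)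
Definition derived_behaviour D (D0 : set S) : Prop :=
  let B := weave m L in
  [/\ triangle L (derived L D0) \/ L (derived L D0) -> triangle B (derived B D),
      L (derived L D0) ->
        (forall j, (1 <= j <= m)%N ->
           triangle B (deriveds B j D) /\ deriveds B j D <> D) /\
        deriveds B m.+1 D = derived B D
    & ~ B (derived B D)].

End Types.

(* The k-th iterate of (p, q, r) |-> (p o q, q o r, r o p), o being the partial
   operation, is defined at (a, b, c) and returns (a, b, c) itself, not merely
   a permutation of it.  When m = 3, D = {(a, i), (b, i+1), (c, i+2)} and
   D0 = {a, b, c} is a triangle, D^(3) = D requires D0^(3) = D0 vertexwise:
   there are configurations in which D0^(3) = D0 as a set but with permuted
   vertices, and then D^(3) differs from D.  For D = {(a, i), (b, i), (c, i)}
   the equality of sets is enough. *)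
Definition vertices_return (S : Type) (L : set (set S)) (k : nat) (a b c : S) :
    Prop :=
  exists x y z : nat -> S,
    [/\ (x 0%N, y 0%N, z 0%N) = (a, b, c), (x k, y k, z k) = (a, b, c)
      & forall j, (j < k)%N ->
          [/\ circ L (x j) (y j) (x j.+1), circ L (y j) (z j) (y j.+1)
            & circ L (z j) (x j) (z j.+1)]].

(* Main.v *)
(** Two distinct points (p, i), (q, j) of the weaved configuration are collinear
    iff p, q are collinear and i, j differ by at most 1, and their product is
    (p o q, k) where k depends on i and j only.  So a triangle has, up to order,
    levels (i, i, i), (i+1, i+1, i), (i, i, i+1) or, when m = 3, (i, i+1, i+2),
    and it projects onto a triangle or a line.  Derivation turns these levels
    into (i+1, i+1, i+1), (i+2, i, i), (i+1, i, i) and (i, i+1, i+2)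
    respectively, while the projection is derived in the original system.  The
    first and the last kinds are stable, so their series follow the series of
    the projection: as a set for equal levels, and vertex by vertex for the
    levels (i, i+1, i+2), where the level identifies the vertex. *)

Require Import Defs.
From mathcomp Require Import all_boot all_algebra.
From mathcomp Require Import boolp classical_sets.

Import GRing.Theory.

Set Implicit Arguments.
Unset Strict Implicit.
Unset Printing Implicit Defensive.
Local Open Scope classical_set_scope.

(** * Three-element sets and their orderings *)

Section ThreeSets.
Context {T : Type}.
Implicit Types (p q r s : T) (A : set T).

Lemma set3_rot p q r : [set p; q; r] = [set q; r; p].
Proof. by rewrite -setUA setUC. Qed.

Lemma set3_swap p q r : [set p; q; r] = [set q; p; r].
Proof. by rewrite (setUC [set p]). Qed.

Lemma set3_swapr p q r : [set p; q; r] = [set p; r; q].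
Proof. exact: setUAC. Qed.

Lemma distinct3_rot p q r : distinct3 p q r -> distinct3 q r p.
Proof. by case. Qed.

(** Each of [p'], [q'], [r'] is found among [p], [q], [r]. As they are distinct, no place is used
    twice, so the six permutations remain out of 27 choices. They come in two groups of three. *)
Lemma set3_memE p q r p' q' r' :
    distinct3 p' q' r' -> [set p; q; r] = [set p'; q'; r'] ->
  [\/ [/\ p = p', q = q' & r = r'], [/\ p = p', q = r' & r = q']
    | [/\ p = q', q = p' & r = r']] \/
  [\/ [/\ p = q', q = r' & r = p'], [/\ p = r', q = p' & r = q']
    | [/\ p = r', q = q' & r = p']].
Proof.
move=> [pq qr rp] E.
have [[|]|] : [set p; q; r] p' by rewrite E; left; left.
all: have [[|]|] : [set p; q; r] q' by rewrite E; left; right.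
all: have [[|]|] : [set p; q; r] r' by rewrite E; right.
all: move=> /= *; subst=> //.
all: by [left; constructor 1 | left; constructor 2 | left; constructor 3
  | right; constructor 1 | right; constructor 2 | right; constructor 3].
Qed.

Lemma three_set3 p q r : three_set [set p; q; r] <-> distinct3 p q r.
Proof.
split=> [[x [y [z [D E]]]]|]; last by exists p, q, r.
have := set3_memE D E; case: D => xy yz zx.
by case=> [[]|[]] [-> -> ->]; split=> //; exact: nesym.
Qed.

Lemma three_setE A p q : three_set A -> A p -> A q -> p <> q ->
  exists2 r, A = [set p; q; r] & distinct3 p q r.
Proof.
move=> A3 Ap Aq pq.
suff [r E] : exists r, A = [set p; q; r].
  by exists r => //; apply/three_set3; rewrite -E.
have [x [y [z [_ E]]]] := A3; move: Ap Aq; rewrite {}E.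
move=> [[|]|] /= ? [[|]|] /= ?; subst => //.
- by exists z.
- by exists y; exact: set3_swapr.
- by exists z; exact: set3_swap.
- by exists x; exact: set3_rot.
- by exists y; rewrite -set3_rot.
- by exists x; rewrite set3_swap -set3_rot.
Qed.

Lemma three_set_sub_eq A p q r :
  three_set A -> distinct3 p q r -> [set p; q; r] `<=` A -> A = [set p; q; r].
Proof.
move=> A3 [pq qr rp] sA.
have Ap : A p by apply: sA; left; left.
have Aq : A q by apply: sA; left; right.
have [s E _] := three_setE A3 Ap Aq pq.
have := sA r (or_intror erefl); rewrite E => -[[|]|] /= rE.
- by case: rp.
- by case: qr.
- by rewrite rE.
Qed.

End ThreeSets.

(** * Lines, triangles and derivation in an arbitrary PSTS *)

Section Steiner.
Context {S : Type} (L : set (set S)) (hL : psts L).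
Implicit Types (p q r x y z : S) (A : set S).

Lemma line_distinct p q r : L [set p; q; r] -> distinct3 p q r.
Proof. by move=> /(proj1 hL) /three_set3. Qed.

Lemma line_third p q r s : L [set p; q; r] -> L [set p; q; s] -> r = s.
Proof.
move=> l1 l2; have D1 := line_distinct l1.
have [pq qr rp] := D1.
have E : [set p; q; r] = [set p; q; s].
  by apply: (proj2 hL p q) => //=; tauto.
have : [set p; q; s] r by rewrite -E; right.
by case=> [[|]|] /= rE; [case: rp|case: qr|].
Qed.

Lemma collinearE p q : p <> q ->
  collinear L p q <-> exists r, L [set p; q; r].
Proof.
move=> pq; split=> [[l [Ll lp lq]]|[r Lr]].
  have [r E _] := three_setE (proj1 hL _ Ll) lp lq pq.
  by exists r; rewrite -E.
by exists [set p; q; r]; split=> //; left; [left|right].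
Qed.

Lemma collinear_sym p q : collinear L p q -> collinear L q p.
Proof. by move=> [l []]; exists l. Qed.

Lemma pairwise_collinear3 p q r : distinct3 p q r ->
  pairwise_collinear L [set p; q; r] <->
  [/\ exists x, L [set p; q; x], exists y, L [set q; r; y]
    & exists z, L [set r; p; z]].
Proof.
move=> [pq qr rp]; split=> [C|[/collinearE-/(_ pq) C1 /collinearE-/(_ qr) C2
    /collinearE-/(_ rp) C3]].
  by split; apply/collinearE => //; apply: C => //=; tauto.
by move=> u v [[|]|] /= -> [[|]|] /= -> // _; apply: collinear_sym.
Qed.

(** A line has exactly three points, so three distinct points lie within a line only if they form
    it. *)
Lemma triangle3 p q r :
  triangle L [set p; q; r] <->
  [/\ distinct3 p q r, pairwise_collinear L [set p; q; r]
    & ~ L [set p; q; r]].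
Proof.
split=> [[/three_set3 D C N]|[D C N]]; split=> //.
- by move=> Ll; apply: N; exists [set p; q; r]; split.
- exact/three_set3.
- move=> [l [Ll sl]]; apply: N.
  by rewrite -(three_set_sub_eq (proj1 hL _ Ll) D sl).
Qed.

Lemma line_pairwise_collinear A : L A -> pairwise_collinear L A.
Proof. by move=> LA p q Ap Aq _; exists A. Qed.

Lemma triangle_or_line A : three_set A -> pairwise_collinear L A ->
  triangle L A \/ L A.
Proof.
move=> [p [q [r [D ->]]]] C; have [?|N] := pselect (L [set p; q; r]).
  by right.
by left; apply/triangle3.
Qed.

Lemma line_not_triangle A : L A -> ~ triangle L A.
Proof. by move=> LA [_ _ N]; apply: N; exists A; split. Qed.

Lemma circ_line p q r : p <> q -> circ L p q r <-> L [set p; q; r].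
Proof. by move=> pq; split=> [[[]|[]]//|]; right. Qed.

Lemma derived3 p q r x y z :
    L [set p; q; x] -> L [set q; r; y] -> L [set r; p; z] ->
  derived L [set p; q; r] = [set x; y; z].
Proof.
move=> Lx Ly Lz.
have [pq _ _] := line_distinct Lx.
have [qr _ _] := line_distinct Ly.
have [rp _ _] := line_distinct Lz.
apply/seteqP; split=> w /=.
  move=> [u [v [Au Av uv]]] /(circ_line _ uv) Luv.
  (* The diagonal pairs drop out; the six ordered pairs left are turned to the orientation of the
     hypotheses, where the third point is unique. *)
  move: Au Av uv Luv => [[|]|] /= -> [[|]|] /= -> // _;
    rewrite ?[[set q; p; w]]set3_swap ?[[set r; q; w]]set3_swap
      ?[[set p; r; w]]set3_swap => Lw.
  1-6: by [rewrite (line_third Lw Lx); left; left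
    | rewrite (line_third Lw Ly); left; right
    | rewrite (line_third Lw Lz); right].
move=> [[|]|] /= ->.
- by exists p, q; split=> //=; [tauto|tauto|right].
- by exists q, r; split=> //=; [tauto|tauto|right].
- by exists r, p; split=> //=; [tauto|tauto|right].
Qed.

(** The product of two points of a line is its remaining point, so derivation only permutes the
    line. *)
Lemma derived_line A : L A -> derived L A = A.
Proof.
move=> LA; have [p [q [r [_ E]]]] := proj1 hL _ LA; move: LA; rewrite E => Lr.
have Er : [set r; p; q] = [set p; q; r] := set3_rot r p q.
rewrite (@derived3 p q r r p q) // ?Er //.
by rewrite -(set3_rot p).
Qed.

Lemma deriveds_line A j : L A -> deriveds L j A = A.
Proof. by move=> LA; elim: j => //= j ->; exact: derived_line. Qed.

(** If two products coincided, their lines would share that product and a vertex; being equal, they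
    would force the other two vertices to coincide. *)
Lemma derived3_distinct p q r x y z : distinct3 p q r ->
    L [set p; q; x] -> L [set q; r; y] -> L [set r; p; z] ->
  distinct3 x y z.
Proof.
have third_neq a b c d e : c <> a ->
    L [set a; b; d] -> L [set b; c; e] -> d <> e.
  rewrite [[set b; c; e]]set3_swapr set3_rot => ca L1 L2 E; subst e.
  exact/ca/(line_third L2).
case=> pq qr rp Lx Ly Lz.
by split; [exact: third_neq Lx Ly | exact: third_neq Ly Lz
  | exact: third_neq Lz Lx].
Qed.

End Steiner.

(** * Derivation of ordered triples *)

Section Step.
Context {S : Type} (L : set (set S)) (hL : psts L).
Implicit Types (p q : S) (t : S * S * S).

(* The product of p and q, with junk value p when they are not collinear. *)
Definition third p q : S :=
  if pselect (exists r, L [set p; q; r]) is left h then projT1 (cid h) else p.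

Lemma thirdP p q : p <> q -> collinear L p q -> L [set p; q; third p q].
Proof.
move=> pq /(collinearE hL pq) h; rewrite /third.
by case: pselect => // h'; case: cid.
Qed.

Lemma thirdE p q r : L [set p; q; r] -> third p q = r.
Proof.
move=> Lr; apply: (line_third hL _ Lr); apply: thirdP.
  by have [] := line_distinct hL Lr.
by exists [set p; q; r]; split=> //=; tauto.
Qed.

Definition vertices t : set S := [set t.1.1; t.1.2; t.2].

Definition distinct_vertices t : Prop := distinct3 t.1.1 t.1.2 t.2.

(** The ordered form of [derived]. It remembers which product goes to which place, as required by
    triangles whose vertices lie on three different levels. *)
Definition step t : S * S * S :=
  (third t.1.1 t.1.2, third t.1.2 t.2, third t.2 t.1.1).

(** The strict bound covers exactly the [n] steps taken: if the vertices of [t] are distinct, the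
    iterates up to index [n] are then genuine products and not junk values of [third]. *)
Definition collinear_until n t : Prop :=
  forall j, (j < n)%N -> pairwise_collinear L (vertices (iter j step t)).

Lemma step_lines t : distinct_vertices t -> pairwise_collinear L (vertices t) ->
  [/\ L [set t.1.1; t.1.2; (step t).1.1], L [set t.1.2; t.2; (step t).1.2]
    & L [set t.2; t.1.1; (step t).2]].
Proof.
by move=> [pq qr rp] C; split; apply: thirdP => //; apply: C => //=;
  rewrite /vertices /=; tauto.
Qed.

Lemma step_distinct t : distinct_vertices t ->
  pairwise_collinear L (vertices t) -> distinct_vertices (step t).
Proof.
by move=> D /(step_lines D)[Lx Ly Lz]; exact: (derived3_distinct hL D Lx Ly Lz).
Qed.

Lemma derived_vertices t : distinct_vertices t ->
  pairwise_collinear L (vertices t) ->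
  derived L (vertices t) = vertices (step t).
Proof.
by move=> D /(step_lines D)[Lx Ly Lz]; exact: (derived3 hL Lx Ly Lz).
Qed.

Lemma iter_step_distinct n t : distinct_vertices t ->
  collinear_until n t -> distinct_vertices (iter n step t).
Proof.
move=> D; elim: n => // n IH C; apply: step_distinct; last exact: C.
by apply: IH => j jn; apply: C; exact: ltnW.
Qed.

Lemma deriveds_vertices n t : distinct_vertices t -> collinear_until n t ->
  deriveds L n (vertices t) = vertices (iter n step t).
Proof.
move=> D; elim: n => // n IH C.
have Cn : collinear_until n t by move=> j jn; apply: C; exact: ltnW.
rewrite /= -derived_vertices -?IH //; first exact: iter_step_distinct.
by rewrite IH //; apply: C.
Qed.

(** Identifying the two series at index j uses collinearity at smaller indices only, so induction
    transfers it from the derived sets to the iterated triples. *)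
Lemma deriveds_collinear_until n t : distinct_vertices t ->
    (forall j, (j < n)%N -> pairwise_collinear L (deriveds L j (vertices t))) ->
  collinear_until n t.
Proof.
move=> D; elim: n => // n IH C.
have Cn : collinear_until n t by apply: IH => j jn; apply: C; exact: ltnW.
move=> j; rewrite ltnS leq_eqVlt => /orP[/eqP->|/Cn //].
by rewrite -deriveds_vertices //; exact: C.
Qed.

(** On distinct points [circ] is single-valued, so the sequences in [vertices_return] can only be
    the coordinates of the iterates of [step]. *)
Lemma vertices_returnE n t : distinct_vertices t -> collinear_until n t ->
  vertices_return L n t.1.1 t.1.2 t.2 <-> iter n step t = t.
Proof.
move=> D C; split=> [[x [y [z [E0 En H]]]]|E]; last first.
  exists (fun j => (iter j step t).1.1), (fun j => (iter j step t).1.2),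
    (fun j => (iter j step t).2); rewrite E; split=> // j jn.
  have Dj : distinct_vertices (iter j step t).
    by apply: iter_step_distinct => // k kj; apply: C; exact: ltn_trans jn.
  have [Lx Ly Lz] := step_lines Dj (C j jn); have [pq qr rp] := Dj.
  by split; apply/circ_line.
have xyzE j : (j <= n)%N -> iter j step t = (x j, y j, z j).
  elim: j => [|j IH] jn; first by rewrite E0; case: (t) => -[].
  have Dj : distinct_vertices (iter j step t).
    by apply: iter_step_distinct => // k kj; apply: C; exact: ltn_trans jn.
  move: Dj; rewrite iterS IH ?(ltnW jn) // => -[/= pq qr rp].
  have [/(circ_line _ _ pq) Lx /(circ_line _ _ qr) Ly /(circ_line _ _ rp) Lz] :=
    H j jn.
  by rewrite /step /= (thirdE Lx) (thirdE Ly) (thirdE Lz).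
by rewrite xyzE // En; case: (t) => -[].
Qed.

Lemma step_line p q r : L [set p; q; r] -> step (p, q, r) = (r, p, q).
Proof.
move=> Lr; rewrite /step /= (thirdE Lr).
rewrite (@thirdE q r p); last by rewrite -set3_rot.
by rewrite (@thirdE r p q) // set3_rot.
Qed.

(** On a line [step] is a cyclic shift, of order three. This closes the series of type (vii), where
    m = 3. *)
Lemma iter3_step_line t : L (vertices t) -> iter 3 step t = t.
Proof.
case: t => -[p q] r /= Lr; rewrite (step_line Lr).
rewrite step_line; last by rewrite set3_rot.
by rewrite step_line // -set3_rot.
Qed.

Lemma iter_step_line n t : L (vertices t) -> L (vertices (iter n step t)).
Proof.
move=> Lt; have D : distinct_vertices t by exact: (line_distinct hL Lt).
elim: n t Lt D => // n IH t Lt D; rewrite iterSr.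
have PC := line_pairwise_collinear Lt.
apply: IH; last exact: step_distinct.
by rewrite -derived_vertices // derived_line.
Qed.

Lemma line_collinear_until n t : L (vertices t) -> collinear_until n t.
Proof.
by move=> Lt j _; apply: line_pairwise_collinear; exact: iter_step_line.
Qed.

End Step.

(** * Arithmetic of levels modulo m *)

Section Levels.
Context (m : nat) (hm : (2 < m)%N).
Local Open Scope ring_scope.
Implicit Types i j k : 'Z_m.

Lemma Zp_natr_eq0 n : (n%:R = 0 :> 'Z_m) <-> (m %| n)%N.
Proof.
split=> [/(congr1 (@nat_of_ord _))|/dvdnP[d ->]].
  by rewrite val_Zp_nat ?(ltn_trans _ hm) //= => /eqP.
by rewrite natrM pchar_Zp ?mulr0 // (ltn_trans _ hm).
Qed.

Lemma Zp_addr_id i n : i + n%:R = i <-> (m %| n)%N.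
Proof.
rewrite -Zp_natr_eq0; split=> [E|->]; last by rewrite addr0.
by apply: (addrI i); rewrite addr0.
Qed.

Lemma Zp_add1_neq i : i + 1 <> i.
Proof.
by move=> /(Zp_addr_id i 1); rewrite dvdn1 => /eqP m1; move: hm; rewrite m1.
Qed.

Lemma Zp_add2_neq i : i + 1 + 1 <> i.
Proof.
rewrite -addrA => /(Zp_addr_id i 2)/(dvdn_leq (ltn0Sn 1)).
by rewrite leqNgt hm.
Qed.

(** As m > 2, it divides 3 only if m = 3; the case distinction on m in the theorem originates
    here. *)
Lemma Zp_add3_eq i : i + 1 + 1 + 1 = i <-> m = 3.
Proof.
rewrite -!addrA (Zp_addr_id i 3).
split=> [/(dvdn_leq (ltn0Sn 2)) le3|-> //].
by apply/eqP; rewrite eqn_leq le3 hm.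
Qed.

(** The level pattern of a line of the weave: the disjuncts tell whether the third, the first or the
    second point is the raised one. *)
Definition line_levels i j k : Prop :=
  [\/ i = j /\ k = i + 1, j = k /\ i = j + 1 | k = i /\ j = k + 1].

(** The domain of the partial product of levels whose graph is [line_levels]. *)
Definition near_levels i j : Prop := [\/ j = i, j = i + 1 | i = j + 1].

Lemma near_levelsE i j : near_levels i j <-> exists k, line_levels i j k.
Proof.
split=> [[->|->|->]|[k [[-> _]|[_ ->]|[-> ->]]]].
- by exists (i + 1); constructor 1.
- by exists i; constructor 3.
- by exists j; constructor 2.
- by constructor 1.
- by constructor 3.
- by constructor 2.
Qed.

Lemma near_levels_sym i j : near_levels i j -> near_levels j i.
Proof. by case=> ->; [constructor 1|constructor 3|constructor 2]. Qed.

Lemma near_levels_add2 i : near_levels i (i + 1 + 1) <-> m = 3.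
Proof.
split=> [[/Zp_add2_neq|/addIr/Zp_add1_neq|/esym/Zp_add3_eq]|m3] //.
by constructor 3; apply/esym/Zp_add3_eq.
Qed.

(** Two different patterns with the same first two levels would give x = x + 1 or x = x + 2, both
    impossible for m > 2. *)
Lemma line_levels_third i j k k' :
  line_levels i j k -> line_levels i j k' -> k = k'.
Proof.
case=> [[? ?]|[? ?]|[? ?]] [[? ?]|[? ?]|[? ?]]; subst => //.
all: exfalso.
all: repeat match goal with
  | E : ?x = ?x + 1 |- _ => exact: (Zp_add1_neq (esym E))
  | E : ?x + 1 = ?x |- _ => exact: (Zp_add1_neq E)
  | E : ?x = ?x + 1 + 1 |- _ => exact: (Zp_add2_neq (esym E))
  end.
Qed.

End Levels.

(** * Periodic series of derived sets *)

Section Periods.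
Context {S : Type} (L : set (set S)).
Implicit Types A : set S.

Lemma derivedsD A j k :
  deriveds L (j + k) A = deriveds L j (deriveds L k A).
Proof. exact: iterD. Qed.

Lemma derivedsSr A j : deriveds L j.+1 A = deriveds L j (derived L A).
Proof. exact: iterSr. Qed.

Lemma periodic_triangles_mul A n n0 : (0 < n0)%N -> (n0 %| n)%N ->
  periodic_triangles L n0 A -> periodic_triangles L n A.
Proof.
move=> n0_gt0 /dvdnP[d ->] [T E].
have Ed e : deriveds L (e * n0) A = A.
  by elim: e => // e IH; rewrite mulSn derivedsD IH.
(* Whole periods are discarded, leaving the index j modulo [n0], which the hypothesis covers. *)
split=> // j _; rewrite (divn_eq j n0) addnC derivedsD Ed.
by apply: T; rewrite ltn_mod.
Qed.

(* Once a line is reached the series is constant, hence it cannot return to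
   a triangle. *)
Lemma periodic_trianglesW A n : psts L -> triangle L A ->
    (forall j, (j < n)%N ->
      three_set (deriveds L j A) /\ pairwise_collinear L (deriveds L j A)) ->
  deriveds L n A = A -> periodic_triangles L n A.
Proof.
move=> hL T C E; split=> // j jn; have [A3 PC] := C j jn.
have [//|LA] := triangle_or_line hL A3 PC.
case: (@line_not_triangle _ L A) => //; rewrite -E -(subnK (ltnW jn)).
by rewrite derivedsD deriveds_line.
Qed.

End Periods.

(** * Lines, collinearity and triangles of the weaved configuration *)

Section Weave.
Context {S : Type} (L : set (set S)) (hL : psts L) (m : nat) (hm : (2 < m)%N).
Notation B := (weave m L).
Local Open Scope ring_scope.
Implicit Types (a b c p q r x y z : S) (i j k u v w : 'Z_m).
Implicit Types A : set S.

(** The points match those of a defining line under one of six permutations, and each position of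
    the raised point arises from two of them. Conversely, a rotation brings the raised point to the
    last place. Through this lemma the product splits into coordinates. *)
Lemma weave3 a b c i j k :
  B [set (a, i); (b, j); (c, k)] <->
  L [set a; b; c] /\ line_levels i j k.
Proof.
split=> [[a' [b' [c' [n [L' E]]]]]|[Labc [[-> ->]|[-> ->]|[-> ->]]]].
- have [ab bc ca] := line_distinct hL L'.
  have D : distinct3 (a', n) (b', n) (c', n + 1) by split=> -[].
  case: (set3_memE D E).
  + case=> -[[-> ->] [-> ->] [-> ->]]; split.
    * by [].
    * by constructor 1.
    * by rewrite set3_swapr.
    * by constructor 3.
    * by rewrite set3_swap.
    * by constructor 1.
  + case=> -[[-> ->] [-> ->] [-> ->]]; split.
    * by rewrite -set3_rot.
    * by constructor 3.
    * by rewrite set3_rot.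
    * by constructor 2.
    * by rewrite set3_swap -set3_rot.
    * by constructor 2.
- by exists a, b, c, j.
- exists b, c, a, k; split; first by rewrite -set3_rot.
  exact: set3_rot.
- exists c, a, b, i; split; first by rewrite set3_rot.
  by rewrite -set3_rot.
Qed.

Lemma weave_psts : psts B.
Proof.
have three l : B l -> three_set l.
  move=> [a [b [c [i [/(line_distinct hL)[ab bc ca] ->]]]]].
  by apply/three_set3; split=> -[].
split=> // P Q l1 l2 PQ B1 B2 P1 Q1 P2 Q2.
have [R1 E1 _] := three_setE (three _ B1) P1 Q1 PQ.
have [R2 E2 _] := three_setE (three _ B2) P2 Q2 PQ.
move: B1 B2; rewrite {}E1 {}E2 {P1 P2 Q1 Q2}.
case: P Q R1 R2 PQ => [p i] [q j] [r k] [s l] _ /weave3[L1 l1'] /weave3[L2 l2'].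
by rewrite (line_third hL L1 L2) (line_levels_third hm l1' l2').
Qed.

Lemma weave_distinct a b c i j k :
  distinct3 a b c -> distinct3 (a, i) (b, j) (c, k).
Proof. by case=> ab bc ca; split=> -[]. Qed.

Lemma weave_collinear p q i j : p <> q ->
  collinear B (p, i) (q, j) <-> collinear L p q /\ near_levels i j.
Proof.
move=> pq; have PQ : (p, i) <> (q, j) by case.
rewrite (collinearE weave_psts PQ) (collinearE hL pq) near_levelsE.
split=> [[[r k] /weave3[Lr lr]]|[[r Lr] [k lk]]].
  by split; [exists r | exists k].
by exists (r, k); apply/weave3.
Qed.

Lemma weave_derived p q r x y z i j k u v w :
    L [set p; q; x] -> L [set q; r; y] -> L [set r; p; z] ->
    line_levels i j u -> line_levels j k v -> line_levels k i w ->
  derived B [set (p, i); (q, j); (r, k)] = [set (x, u); (y, v); (z, w)].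
Proof. by move=> *; apply: (derived3 weave_psts); apply/weave3. Qed.

Lemma weave_pairwise_collinear3 p q r i j k : distinct3 p q r ->
  pairwise_collinear B [set (p, i); (q, j); (r, k)] <->
  pairwise_collinear L [set p; q; r] /\
  [/\ near_levels i j, near_levels j k & near_levels k i].
Proof.
move=> D; rewrite (pairwise_collinear3 weave_psts (weave_distinct _ _ _ D)).
rewrite (pairwise_collinear3 hL D).
split=> [[[[x u] /weave3[Lx lu]] [[y v] /weave3[Ly lv]]
    [[z w] /weave3[Lz lw]]]|[[[x Lx] [y Ly] [z Lz]]
    [/near_levelsE[u lu] /near_levelsE[v lv] /near_levelsE[w lw]]]].
  split; split; [by exists x|by exists y|by exists z|..]; apply/near_levelsE.
  - by exists u.
  - by exists v.
  - by exists w.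
by split; [exists (x, u)|exists (y, v)|exists (z, w)]; apply/weave3.
Qed.

Lemma weave_triangle3 p q r i j k :
  triangle B [set (p, i); (q, j); (r, k)] <->
  [/\ distinct3 p q r, pairwise_collinear L [set p; q; r],
      [/\ near_levels i j, near_levels j k & near_levels k i]
    & ~ (L [set p; q; r] /\ line_levels i j k)].
Proof.
rewrite (triangle3 weave_psts) (propext (weave3 _ _ _ _ _ _)).
split=> [[D C N]|[D C l N]]; last first.
  split=> //; first exact: weave_distinct.
  exact/weave_pairwise_collinear3.
(* At first only the pairs are known to differ. Collinear pairs project into a line of [L], whose
   points are distinct, so no two vertices lie over the same point. *)
suff D' : distinct3 p q r.
  by have [C' l] := proj1 (weave_pairwise_collinear3 _ _ _ D') C.
have [[[x u] /weave3[/(line_distinct hL)[pq _ _] _]]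
  [[y v] /weave3[/(line_distinct hL)[qr _ _] _]]
  [[z w] /weave3[/(line_distinct hL)[rp _ _] _]]] :=
  proj1 (pairwise_collinear3 weave_psts D) C.
by [].
Qed.

(** The relations between i, j and between j, k give nine cases, reduced to four by reordering.
    Nearness of k and i is not recorded; the main proof uses it to get m = 3 from the fourth
    pattern. *)
Lemma triangle_levels D : triangle B D -> exists a b c i,
  [\/ D = [set (a, i); (b, i); (c, i)],
      D = [set (a, i + 1); (b, i + 1); (c, i)],
      D = [set (a, i); (b, i); (c, i + 1)]
    | D = [set (a, i); (b, i + 1); (c, i + 1 + 1)]].
Proof.
move=> T; have [[[a i] [[b j] [[c k] [_ E]]]] _ _] := T.
move: T; rewrite E => /weave_triangle3[_ _ [ij jk _] _] {E}.
case: ij jk => [->|->|->].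
- case=> [->|->|->].
  + by exists a, b, c, i; constructor 1.
  + by exists a, b, c, i; constructor 3.
  + by exists a, b, c, k; constructor 2.
- case=> [->|->|/addIr ->].
  + by exists b, c, a, i; constructor 2; exact: set3_rot.
  + by exists a, b, c, i; constructor 4.
  + by exists a, c, b, k; constructor 3; exact: set3_swapr.
- case=> [->|->|->].
  + by exists b, c, a, j; constructor 3; exact: set3_rot.
  + by exists c, a, b, j; constructor 2; rewrite -set3_rot.
  + by exists c, b, a, k; constructor 4; rewrite set3_rot -set3_swap.
Qed.

Lemma level_set3 a b c i :
  [set (a, i); (b, i); (c, i)] = [set a; b; c] `*` [set i].
Proof.
apply/seteqP; split=> [[x j] /= [[|]|] [-> ->]|[x j] /= [[[|]|] -> ->]];
  by [split=> //; tauto|left; left|left; right|right].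
Qed.

Lemma three_set_level A i : three_set A -> three_set (A `*` [set i]).
Proof.
move=> [a [b [c [D ->]]]]; rewrite -level_set3.
exact/three_set3/weave_distinct.
Qed.

Lemma not_line_level A i : ~ B (A `*` [set i]).
Proof.
move=> [a [b [c [j [_ E]]]]].
have : (A `*` [set i]) (a, j) by rewrite E; left; left.
have : (A `*` [set i]) (c, j + 1) by rewrite E; right.
by move=> [_ /= <-] [_ /= /esym/(Zp_add1_neq hm)].
Qed.

(** Equal levels are near, and no line of the weave stays on one level. So a line of [L] copied to a
    level becomes a triangle just as a triangle does. *)
Lemma triangle_level A i : triangle B (A `*` [set i]) <->
  three_set A /\ pairwise_collinear L A.
Proof.
split=> [T|[A3 C]].
  have [[[a j] [[b k] [[c l] [_ E]]]] _ _] := T.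
  have ABC : A = [set a; b; c].
    apply/seteqP; split=> x => [Ax|].
      have : (A `*` [set i]) (x, i) by [].
      by rewrite E /= => -[[[]|[]]|[]]; tauto.
    have [Aa _] : (A `*` [set i]) (a, j) by rewrite E; left; left.
    have [Ab _] : (A `*` [set i]) (b, k) by rewrite E; left; right.
    have [Ac _] : (A `*` [set i]) (c, l) by rewrite E; right.
    by move=> [[|]|] /= ->.
  by move: T; rewrite ABC -level_set3 => /weave_triangle3[/three_set3].
suff PC : pairwise_collinear B (A `*` [set i]).
  have [//|] := triangle_or_line weave_psts (three_set_level _ A3) PC.
  by move/not_line_level.
move=> [p j] [q k] [/= Ap ->] [/= Aq ->] pq.
have {}pq : p <> q by move=> E; apply: pq; rewrite E.
by apply/weave_collinear => //; split; [exact: C | constructor 1].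
Qed.

(** Two points on level i have their product on level i + 1, since the other two patterns would make
    i equal to i + 1. *)
Lemma derived_level A i :
  derived B (A `*` [set i]) = derived L A `*` [set i + 1].
Proof.
apply/seteqP; split=> -[x k] /=.
  move=> [[p j] [[q l] [[/= Ap ->] [/= Aq ->] pq C]]].
  have pq' : p <> q by move=> E; apply: pq; rewrite E.
  move: C => /(circ_line _ _ pq)/weave3[Lx [[_ ->]|[_]|[->]]].
  - by split=> //; exists p, q; split=> //; apply/circ_line.
  - by move=> /esym/(Zp_add1_neq hm).
  - by move=> /esym/(Zp_add1_neq hm).
move=> [[p [q [Ap Aq pq C]]] ->].
exists (p, i), (q, i); split=> //; first by case.
apply/circ_line; first by case.
by apply/weave3; split; [exact/(circ_line L _ pq)|constructor 1].
Qed.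

Lemma deriveds_level A i (j : nat) :
  deriveds B j (A `*` [set i]) = deriveds L j A `*` [set i + j%:R].
Proof.
elim: j => [|j IH]; first by rewrite addr0.
by rewrite mulrSr addrA -derived_level -IH.
Qed.

Lemma level_inj A A' i j : three_set A ->
  A `*` [set i] = A' `*` [set j] -> A = A' /\ i = j.
Proof.
move=> [a [b [c [_ E]]]] EA.
have ij : i = j.
  have : (A `*` [set i]) (a, i) by split=> //; rewrite E; left; left.
  by rewrite EA => -[].
subst j; split=> //; apply/seteqP; split=> x Ax.
  have : (A `*` [set i]) (x, i) by [].
  by rewrite EA => -[].
have : (A' `*` [set i]) (x, i) by [].
by rewrite -EA => -[].
Qed.

Lemma level_behaviour A i : triangle L A ->
  derived_behaviour L (A `*` [set i]) A.
Proof.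
move=> TA; have [A3 _ _] := TA; split.
- rewrite derived_level => -[[A3' C _]|LA].
    exact/triangle_level.
  apply/triangle_level; split; first exact: (proj1 hL).
  exact: line_pairwise_collinear.
- move=> LA; split=> [[|j]|]; first by [].
  (* From index 1 on the projection is one fixed line and only the level moves. A line is not the
     triangle [A], so [D] never recurs. *)
  + move=> _; rewrite deriveds_level derivedsSr deriveds_line //; split.
      apply/triangle_level; split; first exact: (proj1 hL).
      exact: line_pairwise_collinear.
    move=> /level_inj-/(_ (proj1 hL _ LA))[E _].
    by apply: (line_not_triangle LA); rewrite E.
  + rewrite deriveds_level derived_level derivedsSr.
    rewrite deriveds_line // mulrSr.
    by rewrite (proj2 (Zp_natr_eq0 hm m)) ?add0r.
- by rewrite derived_level; exact: not_line_level.
Qed.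

Lemma level_periodic A i : triangle L A ->
  periodic_triangles B m (A `*` [set i]) <->
  exists m0, [/\ (0 < m0)%N, periodic_triangles L m0 A & (m0 %| m)%N].
Proof.
move=> TA; have m0 := Zp_natr_eq0 hm m.
have per : periodic_triangles B m (A `*` [set i]) <->
    periodic_triangles L m A.
  split=> [[T E]|[T E]].
    (* A triangle on one level may project to a line, so the hypothesis yields only three collinear
       points; the return to the triangle [A] excludes lines. *)
    apply: periodic_trianglesW => // [j /T|].
      by rewrite deriveds_level => /triangle_level.
    move: E; rewrite deriveds_level => /esym E; have [A3 _ _] := TA.
    by have [<-] := level_inj A3 E.
  split=> [j /T[? ? _]|]; first by rewrite deriveds_level; apply/triangle_level.
  by rewrite deriveds_level E (proj2 m0) ?addr0.
rewrite per; split=> [P|[n [n_gt0 P nm]]].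
  by exists m; split=> //; exact: leq_trans hm.
exact: periodic_triangles_mul P.
Qed.

Lemma level_line_periodic A i : L A ->
  periodic_triangles B m (A `*` [set i]).
Proof.
move=> LA; split=> [j _|]; rewrite deriveds_level deriveds_line //.
  apply/triangle_level; split; first exact: (proj1 hL).
  exact: line_pairwise_collinear.
by rewrite (proj2 (Zp_natr_eq0 hm m)) ?addr0.
Qed.

Lemma line_cyclic_products a b c : L [set a; b; c] ->
  [/\ L [set a; b; c], L [set b; c; a] & L [set c; a; b]].
Proof. by move=> l; split=> //; [rewrite -set3_rot | rewrite set3_rot]. Qed.

(** The levels of types (iii) and (iv), counted from the lowest point. The result has one point two
    levels above the others. *)
Lemma derived_low a b c x y z i :
    L [set a; b; x] -> L [set b; c; y] -> L [set c; a; z] ->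
  derived B [set (a, i + 1); (b, i + 1); (c, i)] =
  [set (x, i + 1 + 1); (y, i); (z, i)].
Proof.
move=> Lx Ly Lz; apply: weave_derived => //.
- by constructor 1.
- by constructor 2.
- by constructor 3.
Qed.

(** The levels of type (v). Those of the result again form a line pattern, so its projection decides
    whether it is a line. *)
Lemma derived_high a b c x y z i :
    L [set a; b; x] -> L [set b; c; y] -> L [set c; a; z] ->
  derived B [set (a, i); (b, i); (c, i + 1)] =
  [set (x, i + 1); (y, i); (z, i)].
Proof.
move=> Lx Ly Lz; apply: weave_derived => //.
- by constructor 1.
- by constructor 3.
- by constructor 2.
Qed.

(** The product of levels k and k + 1 has level k. With m = 3 this also applies to i + 2 and i = (i
    + 2) + 1, so the level pattern is preserved. *)
Lemma derived_spread a b c x y z i : m = 3 ->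
    L [set a; b; x] -> L [set b; c; y] -> L [set c; a; z] ->
  derived B [set (a, i); (b, i + 1); (c, i + 1 + 1)] =
  [set (x, i); (y, i + 1); (z, i + 1 + 1)].
Proof.
move=> m3 Lx Ly Lz; apply: weave_derived => //.
- by constructor 3.
- by constructor 3.
- by constructor 3; split=> //; apply/esym/Zp_add3_eq.
Qed.

(** * Derived triples of types (iii) and (iv) *)

Section TwoBelow.
Context (x y z : S) (i : 'Z_m) (D : distinct3 x y z).
Let T : set (S * 'Z_m) := [set (x, i + 1 + 1); (y, i); (z, i)].

Let not_near : m <> 3 -> ~ near_levels (i + 1 + 1) i.
Proof. by move=> m3 /near_levels_sym/(near_levels_add2 hm). Qed.

Lemma two_below_not_line : ~ B T.
Proof.
by move=> /weave3[_ [[/(Zp_add2_neq hm)]|[_ /addIr/(Zp_add1_neq hm)]|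
  [/esym/(Zp_add2_neq hm)]]].
Qed.

Lemma two_below_not_triangle : m <> 3 -> ~ triangle B T.
Proof. by move=> m3 /weave_triangle3[_ _ [/(not_near m3)]]. Qed.

Lemma two_below_triangle : m = 3 ->
  triangle B T <-> pairwise_collinear L [set x; y; z].
Proof.
move=> m3; split=> [/weave_triangle3[]//|C]; apply/weave_triangle3; split=> //.
  have n := proj2 (near_levels_add2 hm i) m3.
  by split=> //; [exact: near_levels_sym|constructor 1].
by move=> /weave3/two_below_not_line.
Qed.

(** For m other than 3 the raised point is not near the two others, so only the pair on level i can
    be collinear. *)
Lemma two_below_pair_and_point : m <> 3 -> collinear L y z ->
  pair_and_point B T.
Proof.
move=> m3 C; have [xy yz zx] := D.
exists (y, i), (z, i), (x, i + 1 + 1); split.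
- exact/distinct3_rot/weave_distinct.
- exact: set3_rot.
- by apply/weave_collinear => //; split=> //; constructor 1.
- by move=> /(weave_collinear _ _ xy)[_ /(not_near m3)].
- move=> xz.
  by have [_ /near_levels_sym/(not_near m3)] :=
    proj1 (weave_collinear _ _ zx) (collinear_sym xz).
Qed.

Lemma two_below_noncollinear : m <> 3 -> ~ collinear L y z ->
  pairwise_noncollinear B T.
Proof.
move=> m3 C; have [xy yz zx] := D.
have nxy : ~ collinear B (x, i + 1 + 1) (y, i).
  by move=> /(weave_collinear _ _ xy)[_ /(not_near m3)].
have nyz : ~ collinear B (y, i) (z, i).
  by move=> /(weave_collinear _ _ yz)[].
have nzx : ~ collinear B (z, i) (x, i + 1 + 1).
  by move=> /(weave_collinear _ _ zx)[_ /near_levels_sym/(not_near m3)].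
have sym P Q : ~ collinear B P Q -> ~ collinear B Q P.
  by move=> N C'; apply: N; exact: collinear_sym.
by move=> p q [[|]|] /= -> [[|]|] /= -> // _; apply: sym.
Qed.

End TwoBelow.

(** * Triangles on three different levels, m = 3 *)

Section Spread.
Context (m3 : m = 3).
Implicit Types t : S * S * S.
Local Notation step := (step L).

Definition spread t i : set (S * 'Z_m) :=
  [set (t.1.1, i); (t.1.2, i + 1); (t.2, i + 1 + 1)].

(** The three levels differ, so the set determines the order of the triple. Hence a return of the
    set is a return of each vertex. *)
Lemma spread_inj t t' i : spread t i = spread t' i -> t = t'.
Proof.
move=> E; have n1 := Zp_add1_neq hm; have n2 := Zp_add2_neq hm.
case: t t' E => [[a b] c] [[a' b'] c'] E.
have split_pair (x y : S) (j k : 'Z_m) : (x, j) = (y, k) -> x = y /\ j = k.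
  by move=> [-> ->].
have : spread (a', b', c') i (a, i) by rewrite -E; left; left.
have : spread (a', b', c') i (b, i + 1) by rewrite -E; left; right.
have : spread (a', b', c') i (c, i + 1 + 1) by rewrite -E; right.
move=> [[|]|] /= /split_pair[-> e1] [[|]|] /= /split_pair[-> e2]
  [[|]|] /= /split_pair[-> e3] //; exfalso.
all: by [exact: (n1 _ e1) | exact: (n2 _ e1) | exact: (n1 _ e2)
  | exact: (n1 _ (esym e2)) | exact: (n1 _ (esym e3))
  | exact: (n2 _ (esym e3))].
Qed.

Lemma spread_not_line t i : ~ B (spread t i).
Proof.
move=> /weave3[_ [[]|[]|[]]].
- by move=> /esym/(Zp_add1_neq hm).
- by move=> /esym/(Zp_add1_neq hm).
- by move=> /(Zp_add2_neq hm).
Qed.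

Lemma spread_triangle t i : triangle B (spread t i) <->
  distinct_vertices t /\ pairwise_collinear L (vertices t).
Proof.
split=> [/weave_triangle3[]//|[D C]]; apply/weave_triangle3; split=> //.
  split; [by constructor 2|by constructor 2|].
  exact/near_levels_sym/(near_levels_add2 hm).
by move=> /weave3/spread_not_line.
Qed.

Lemma deriveds_spread n t i : distinct_vertices t -> collinear_until L n t ->
  deriveds B n (spread t i) = spread (iter n step t) i.
Proof.
move=> D; elim: n => // n IH C.
have Cn : collinear_until L n t by move=> j jn; apply: C; exact: ltnW.
have [Lx Ly Lz] := step_lines hL (iter_step_distinct hL D Cn) (C n (leqnn _)).
by rewrite /= IH //; exact: derived_spread.
Qed.

Lemma spread_triangles_until n t i : distinct_vertices t ->
  (forall j : nat, (j < n)%N -> triangle B (deriveds B j (spread t i))) <->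
  collinear_until L n t.
Proof.
move=> D; split=> [|C j jn].
  elim: n => // n IH T.
  have Cn : collinear_until L n t by apply: IH => j jn; apply: T; exact: ltnW.
  move=> j; rewrite ltnS leq_eqVlt => /orP[/eqP->|/Cn //].
  have := T n (leqnn _); rewrite deriveds_spread //.
  by move=> /spread_triangle[].
have Cj : collinear_until L j t by move=> k kj; apply: C; exact: ltn_trans jn.
rewrite deriveds_spread //; apply/spread_triangle; split; last exact: C.
exact: (iter_step_distinct hL).
Qed.

Lemma spread_line_periodic t i : L (vertices t) ->
  periodic_triangles B m (spread t i).
Proof.
move=> Lt; have D : distinct_vertices t by exact: (line_distinct hL Lt).
have C n := @line_collinear_until _ _ hL n _ Lt.
split; first exact/spread_triangles_until.
(* Only the iteration count is rewritten, because m also occurs in the type of the levels. *)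
by rewrite deriveds_spread // [X in iter X]m3 iter3_step_line.
Qed.

Lemma spread_behaviour t i : triangle L (vertices t) ->
  derived_behaviour L (spread t i) (vertices t).
Proof.
move=> T; have [D PC _] := proj1 (triangle3 hL _ _ _) T.
have Ds := step_distinct hL D PC.
have D'E : derived B (spread t i) = spread (step t) i.
  by have [] := step_lines hL D PC; exact: derived_spread.
rewrite /derived_behaviour derived_vertices //; split.
- rewrite D'E => -[[_ C _]|/line_pairwise_collinear C];
  exact/spread_triangle.
- move=> Ls.
  (* Index 0 is the given triangle; all later terms are orderings of one line. *)
  have C n : collinear_until L n t.
    case: n => // n [_ //|j]; rewrite ltnS iterSr => jn.
    exact: (@line_collinear_until _ _ hL n).
  split=> [[//|j _]|].
    split; first exact: (proj2 (spread_triangles_until j.+2 i D)).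
    rewrite deriveds_spread // => /spread_inj Et.
    apply: (line_not_triangle _ T); rewrite -Et iterSr.
    exact: iter_step_line.
  by rewrite D'E deriveds_spread // iterSr [X in iter X]m3 iter3_step_line.
- by rewrite D'E; exact: spread_not_line.
Qed.

Lemma spread_periodic t i : triangle L (vertices t) ->
  periodic_triangles B m (spread t i) <->
  exists m0, [/\ (0 < m0)%N, periodic_triangles L m0 (vertices t), (m0 %| m)%N
                & vertices_return L m0 t.1.1 t.1.2 t.2].
Proof.
move=> T; have [D PC _] := proj1 (triangle3 hL _ _ _) T.
split=> [[TB E]|[m0 [m0_gt0 P dvd_m0 R]]].
  have C := proj1 (spread_triangles_until m i D) TB.
  have {}E : iter m step t = t.
    by apply: (@spread_inj _ _ i); rewrite -deriveds_spread.
  exists m; split=> //; [exact: leq_trans hm| |exact/vertices_returnE].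
  apply: (periodic_trianglesW hL T) => [j jm|]; last first.
    by rewrite deriveds_vertices // E.
  have Cj : collinear_until L j t by move=> k kj; apply: C; exact: ltn_trans jm.
  rewrite deriveds_vertices //; split; last exact: C.
  exact/three_set3/(iter_step_distinct hL).
have periodC n : periodic_triangles L n (vertices t) -> collinear_until L n t.
  by move=> [Tn _]; apply: deriveds_collinear_until => // j /Tn[].
have Cm := periodC _ (periodic_triangles_mul m0_gt0 dvd_m0 P).
have {}R := proj1 (vertices_returnE hL D (periodC _ P)) R.
split; first exact/spread_triangles_until.
rewrite deriveds_spread //; have /dvdnP[d mE] := dvd_m0.
(* m is a multiple of [m0], and [m0] steps already fix the ordered triple. *)
have -> // : iter m step t = t.
by rewrite mE; elim: d {mE} => // d IH; rewrite mulSn iterD IH.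
Qed.

(** A return of the projection as a set, possibly with permuted vertices, keeps all terms collinear,
    which is enough for triangles though not for periodicity. *)
Lemma spread_triangles t i : triangle L (vertices t) ->
    (exists m0, [/\ (0 < m0)%N, periodic_triangles L m0 (vertices t)
                  & (m0 %| m)%N]) ->
  forall j : nat, (j < m)%N -> triangle B (deriveds B j (spread t i)).
Proof.
move=> T [m0 [m0_gt0 P dvd_m0]]; have [D _ _] := proj1 (triangle3 hL _ _ _) T.
apply/spread_triangles_until => //; apply: deriveds_collinear_until => // j jm.
by have [/(_ j jm)[]] := periodic_triangles_mul m0_gt0 dvd_m0 P.
Qed.

Lemma spread_line_cover a b c i : L [set a; b; c] ->
  let D := spread (a, b, c) i in
  let D1 := [set a; b; c] `*` [set i] in
  D `|` derived B D `|` deriveds B 2 D =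
  D1 `|` derived B D1 `|` deriveds B 2 D1.
Proof.
move=> Labc D D1; have Lt : L (vertices (a, b, c)) by [].
have Dv : distinct_vertices (a, b, c) by exact: (line_distinct hL Labc).
have [_ _ Lc] := line_cyclic_products Labc.
have C n := @line_collinear_until _ _ hL n _ Lt.
rewrite -[derived B D]/(deriveds B 1 D) -[derived B D1]/(deriveds B 1 D1).
rewrite /D (deriveds_spread _ Dv (C 1)) (deriveds_spread _ Dv (C 2)).
rewrite /D1 !deriveds_level !deriveds_line //.
rewrite !iterS (step_line hL Labc) (step_line hL Lc).
rewrite -[i + 2%:R]/(i + (1 + 1)) addrA.
have pairE (x y : S) (j k : 'Z_m) : ((x, j) = (y, k)) = (x = y /\ j = k).
  by apply: propext; split=> [|[-> ->]] // [-> ->].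
(* Both unions consist of all points over a, b, c on the levels i, i + 1, i + 2: on one side the
   line shifts cyclically across the levels, on the other it climbs them. *)
by apply/seteqP; split=> -[x j]; rewrite /spread /= !pairE; tauto.
Qed.

End Spread.

End Weave.

(** * The classification of triangles *)

Theorem lemma2p2 (S : Type) (L : set (set S)) (m : nat)
    (hL : psts L) (hm : (3 <= m)%N) :
  let B := weave m L in
  (forall D : set (S * 'Z_m), triangle B D ->
    (exists a b c, let D0 := [set a; b; c] in
      [/\ type_i L D a b c,
          derived_behaviour L D D0
        & periodic_triangles B m D <->
          exists m0, [/\ (0 < m0)%N, periodic_triangles L m0 D0
                       & (m0 %| m)%N]]) \/
    (exists a b c,
      type_ii L D a b c /\ periodic_triangles B m D) \/
    (exists a b c,
      [/\ type_iii L D a b c,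
          ~ B (derived B D),
          m <> 3%N -> ~ triangle B (derived B D) /\
                      pair_and_point B (derived B D)
        & m = 3%N -> triangle B (derived B D)]) \/
    (exists a b c, let D0 := [set a; b; c] in
      [/\ type_iv L D a b c,
          ~ B (derived B D),
          m <> 3%N -> ~ triangle B (derived B D) /\
                      (pair_and_point B (derived B D) \/
                       (three_set (derived B D) /\
                        pairwise_noncollinear B (derived B D)))
        & m = 3%N -> (triangle B (derived B D) <->
                      pairwise_collinear L (derived L D0))]) \/
    (exists a b c, let D0 := [set a; b; c] in
      [/\ type_v L D a b c,
          B (derived B D) <-> L (derived L D0)
        & triangle L (derived L D0) -> triangle B (derived B D)]) \/
    (exists a b c, let D0 := [set a; b; c] in
      [/\ type_vi L D a b c,
          derived_behaviour L D D0,
          periodic_triangles B m D <->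
          exists m0, [/\ (0 < m0)%N, periodic_triangles L m0 D0,
                         (m0 %| m)%N & vertices_return L m0 a b c]
        & (exists m0, [/\ (0 < m0)%N, periodic_triangles L m0 D0
                        & (m0 %| m)%N]) ->
          forall j, (j < m)%N -> triangle B (deriveds B j D)]) \/
    (exists a b c,
      type_vii L D a b c /\ periodic_triangles B m D)) /\
  (m <> 3%N ->
    ~ exists (D : set (S * 'Z_m)) a b c,
        triangle B D /\ (type_vi L D a b c \/ type_vii L D a b c)) /\
  (m = 3%N ->
    (forall a b c, triangle L [set a; b; c] ->
       exists D : set (S * 'Z_m), triangle B D /\ type_vi L D a b c) /\
    (forall a b c, L [set a; b; c] ->
       exists D : set (S * 'Z_m), triangle B D /\ type_vii L D a b c)) /\
  (forall (D : set (S * 'Z_m)) a b c, triangle B D -> type_vii L D a b c ->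
    exists (D1 : set (S * 'Z_m)) a1 b1 c1,
      [/\ triangle B D1, type_ii L D1 a1 b1 c1
        & D `|` derived B D `|` deriveds B 2 D =
          D1 `|` derived B D1 `|` deriveds B 2 D1]).
Proof.
move=> B; split; [|split; [|split]].
- move=> D T; have [a [b [c [i]]]] := triangle_levels hL hm T.
  have shape j k l : D = [set (a, j); (b, k); (c, l)] ->
      [/\ distinct3 a b c, pairwise_collinear L [set a; b; c],
          near_levels l j & ~ (L [set a; b; c] /\ line_levels j k l)] /\
      (triangle L [set a; b; c] \/ L [set a; b; c]).
    move=> E; move: T; rewrite E => /(weave_triangle3 hL hm)[D3 C [_ _ n] N].
    split=> //; apply: (triangle_or_line hL) => //; exact/three_set3.
  (* Four level patterns and two kinds of projection make eight cases: in order, types (i), (ii),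
     (iv), (iii), (v), a contradiction, (vi), (vii). *)
  move=> [] E; have [[D3 C n N] [Tabc|Labc]] := shape _ _ _ E.
  + left; exists a, b, c; rewrite E level_set3; split.
    * by split=> //; exists i; rewrite level_set3.
    * exact: level_behaviour.
    * exact: level_periodic.
  + right; left; exists a, b, c; rewrite E; split.
      by split=> //; exists i.
    by rewrite level_set3; exact: level_line_periodic.
  + have [[x Lx] [y Ly] [z Lz]] := proj1 (pairwise_collinear3 hL D3) C.
    have Dxyz := derived3_distinct hL D3 Lx Ly Lz.
    do 3!right; left; exists a, b, c => D0; rewrite /D0 E.
    rewrite (derived_low hL hm i Lx Ly Lz) (derived3 hL Lx Ly Lz); split.
    (* The type counts levels from the upper pair, the pattern from the lower point. *)
    * by split=> //; exists (i + 1)%R; rewrite addrK.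
    * exact: two_below_not_line.
    * move=> m3; split; first exact: two_below_not_triangle.
      have [yz|yz] := pselect (collinear L y z).
        by left; exact: two_below_pair_and_point.
      right; split; first exact/three_set3/weave_distinct.
      exact: two_below_noncollinear.
    * exact: two_below_triangle.
  + have [Lx Ly Lz] := line_cyclic_products Labc.
    have Dxyz := derived3_distinct hL D3 Lx Ly Lz.
    right; right; left; exists a, b, c; rewrite E.
    rewrite (derived_low hL hm i Lx Ly Lz); split.
    * by split=> //; exists (i + 1)%R; rewrite addrK.
    * exact: two_below_not_line.
    * move=> m3; split; first exact: two_below_not_triangle.
      by apply: two_below_pair_and_point => //; exists [set a; b; c];
        split=> //=; tauto.
    * move=> m3; apply/(two_below_triangle hL hm i Dxyz m3).
      rewrite set3_rot; exact: C.
  + have [[x Lx] [y Ly] [z Lz]] := proj1 (pairwise_collinear3 hL D3) C.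
    have Dxyz := derived3_distinct hL D3 Lx Ly Lz.
    do 4!right; left; exists a, b, c => D0; rewrite /D0 E.
    rewrite (derived_high hL hm i Lx Ly Lz) (derived3 hL Lx Ly Lz); split.
    * by split=> //; exists i.
    * split=> [/(weave3 hL)[]//|Lxyz]; apply/weave3 => //; split=> //.
      by constructor 2.
    * move=> /(triangle3 hL)[_ C' N']; apply/weave_triangle3 => //; split=> //.
      - by split; [constructor 3|constructor 1|constructor 2].
      - by case.
  (* A line of [L] on these levels is a line of the weave, hence no triangle. *)
  + by case: N; split=> //; constructor 1.
  + have m3 : m = 3 by apply/(near_levels_add2 hm i)/near_levels_sym.
    do 5!right; left; exists a, b, c; rewrite E; split.
    * by split=> //; exists i; rewrite -[(i + 2%:R)%R]/(i + (1 + 1))%R addrA.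
    * exact: (@spread_behaviour _ _ hL _ hm m3 (a, b, c)).
    * exact: (@spread_periodic _ _ hL _ hm m3 (a, b, c)).
    * exact: (@spread_triangles _ _ hL _ hm m3 (a, b, c)).
  + have m3 : m = 3 by apply/(near_levels_add2 hm i)/near_levels_sym.
    do 6!right; exists a, b, c; rewrite E; split.
      by split=> //; exists i; rewrite -[(i + 2%:R)%R]/(i + (1 + 1))%R addrA.
    exact: (@spread_line_periodic _ _ hL _ hm m3 (a, b, c)).
(* The first and last vertices of types (vi) and (vii) are two levels apart, and these levels are
   near only if m = 3. *)
- move=> m3 [D [a [b [c [T]]]]].
  by case=> -[_ [i E]]; move: T; rewrite E -[(i + 2%:R)%R]/(i + (1 + 1))%R addrA
    => /(weave_triangle3 hL hm)[_ _
      [_ _ /near_levels_sym/(near_levels_add2 hm)]].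
- move=> m3; have TP a b c : distinct3 a b c ->
      pairwise_collinear L [set a; b; c] ->
      triangle B [set (a, 0%R); (b, 0 + 1)%R; (c, 0 + 2%:R)%R].
    move=> D C; rewrite -[(0 + 2%:R)%R]/(0 + (1 + 1))%R addrA.
    exact/(@spread_triangle _ _ hL _ hm m3 (a, b, c)).
  split=> a b c.
    move=> T; have [D C _] := proj1 (triangle3 hL _ _ _) T.
    by eexists; split; [exact: TP D C | split=> //; exists 0%R].
  move=> Labc; have D := line_distinct hL Labc.
  by eexists; split; [exact: TP D (line_pairwise_collinear Labc)
    | split=> //; exists 0%R].
- move=> D a b c T [Labc [i E]].
  rewrite -[(i + 2%:R)%R]/(i + (1 + 1))%R addrA in E.
  move: T; rewrite E => /(weave_triangle3 hL hm)[_ _ [_ _ n] _].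
  have m3 : m = 3 by apply/(near_levels_add2 hm i)/near_levels_sym.
  exists ([set a; b; c] `*` [set i]), a, b, c; split.
  + apply/(triangle_level hL hm); split; first exact: (proj1 hL).
    exact: line_pairwise_collinear.
  + by split=> //; exists i; rewrite level_set3.
  + exact: (@spread_line_cover _ _ hL _ hm m3).
Qed.
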